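(* Let $m_1,m_2>0$, $\mathbf k\in\mathbb R^3$, $\theta\in\mathbb R$, $t\in\mathbb R$ and $\sigma\in\{e,\mu\}$. With $\mathcal Q_{\sigma\to\rho}(t)$ and $\mathcal C(t)$ as defined in the context, set $$\mathcal F_{QFT}=\mathcal Q_{\sigma\to\sigma}(t)\,\bigl(1-\mathcal Q_{\sigma\to\sigma}(t)\bigr)-\tfrac14\,\mathcal C^2(t),\qquad \mathcal W_{QFT}=\mathcal Q_{e\to e}(t)\,\mathcal Q_{\mu\to e}(t)-\mathcal Q_{\mu\to e}(2t).$$ Then $$\mathcal F_{QFT}-\mathcal W_{QFT}\;\ge\;0,$$ that is, $\mathcal F_{QFT}$ is always an upper bound to $\mathcal W_{QFT}$.
   Context: For $i=1,2$ let $\omega_{\mathbf k,i}=\sqrt{|\mathbf k|^2+m_i^2}$ and $\omega_{\mathbf k}^{\pm}=(\omega_{\mathbf k,2}\pm\omega_{\mathbf k,1})/2$. Define $$\mathcal A_{\mathbf k}=\sqrt{\frac{\omega_{\mathbf k,1}+m_1}{2\omega_{\mathbf k,1}}\cdot\frac{\omega_{\mathbf k,2}+m_2}{2\omega_{\mathbf k,2}}},$$ $$|U_{\mathbf k}|=\mathcal A_{\mathbf k}\Bigl(1+\frac{|\mathbf k|^2}{(\omega_{\mathbf k,1}+m_1)(\omega_{\mathbf k,2}+m_2)}\Bigr),\qquad |V_{\mathbf k}|=\mathcal A_{\mathbf k}\Bigl(\frac{|\mathbf k|}{\omega_{\mathbf k,1}+m_1}-\frac{|\mathbf k|}{\omega_{\mathbf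 k,2}+m_2}\Bigr).$$ Here $|U_{\mathbf k}|$ and $|V_{\mathbf k}|$ are names for the real numbers given by these formulas; only their squares $|U_{\mathbf k}|^2,|V_{\mathbf k}|^2$ are used. For two distinct flavors $\sigma\ne\rho$ in $\{e,\mu\}$ the field-theoretical oscillation probabilities are $$\mathcal Q_{\sigma\to\rho}(t)=\sin^2(2\theta)\bigl[|U_{\mathbf k}|^2\sin^2(\omega_{\mathbf k}^{-}t)+|V_{\mathbf k}|^2\sin^2(\omega_{\mathbf k}^{+}t)\bigr],\qquad \mathcal Q_{\sigma\to\sigma}(t)=1-\mathcal Q_{\sigma\to\rho}(t).$$ The function $\mathcal C(t)$ (the absolute value of the expectation of the commutator of the flavor charge and the mass charge, divided by the mixing mass $m_{e\mu}$) is $$\mathcal C(t)=\sin(2\theta)\,\bigl|\,|U_{\mathbf k}|^2\sin(2\omega_{\mathbf k}^{-}t)+|V_{\mathbf k}|^2\sin(2\omega_{\mathbf k}^{+}t)\bigr|.$$ The Leggett--Garg inequality in Wigner form is $\mathcal W_{QFT}\le 0$; it is violated when $\mathcal W_{QFT}>0$. *)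

(* Defs.v *)
(* MathComp-Analysis: the reals are an arbitrary [R : realType]. *)
From mathcomp Require Import all_boot all_order all_algebra.
From mathcomp Require Import reals trigo.

Set Implicit Arguments.
Unset Strict Implicit.
Unset Printing Implicit Defensive.

Import Order.TTheory GRing.Theory Num.Theory.
Local Open Scope ring_scope.

Inductive flavor := flavor_e | flavor_mu.

(* Euclidean norm; the library norm on row vectors is the sup norm. *)
Definition norm_euclid (R : realType) (k : 'rV[R]_3) : R :=
  Num.sqrt (\sum_(i < 3) k 0 i ^+ 2).

Definition omega (R : realType) (m : R) (k : 'rV[R]_3) : R :=
  Num.sqrt (norm_euclid k ^+ 2 + m ^+ 2).

Definition omega_minus (R : realType) (m1 m2 : R) (k : 'rV[R]_3) : R :=
  (omega m2 k - omega m1 k) / 2.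

Definition omega_plus (R : realType) (m1 m2 : R) (k : 'rV[R]_3) : R :=
  (omega m2 k + omega m1 k) / 2.

Definition bogo_A (R : realType) (m1 m2 : R) (k : 'rV[R]_3) : R :=
  Num.sqrt ((omega m1 k + m1) / (2 * omega m1 k) *
            ((omega m2 k + m2) / (2 * omega m2 k))).

Definition bogo_U (R : realType) (m1 m2 : R) (k : 'rV[R]_3) : R :=
  bogo_A m1 m2 k *
  (1 + norm_euclid k ^+ 2 / ((omega m1 k + m1) * (omega m2 k + m2))).

(* The quantity written |V_k|: it is negative when m1 > m2 and k != 0. *)
Definition bogo_V (R : realType) (m1 m2 : R) (k : 'rV[R]_3) : R :=
  bogo_A m1 m2 k *
  (norm_euclid k / (omega m1 k + m1) - norm_euclid k / (omega m2 k + m2)).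

Definition Q_change (R : realType) (m1 m2 : R) (k : 'rV[R]_3) (theta t : R)
    : R :=
  sin (2 * theta) ^+ 2 *
  (bogo_U m1 m2 k ^+ 2 * sin (omega_minus m1 m2 k * t) ^+ 2 +
   bogo_V m1 m2 k ^+ 2 * sin (omega_plus m1 m2 k * t) ^+ 2).

(* [Qprob m1 m2 k theta sigma rho t] is Q_{sigma -> rho}(t). *)
Definition Qprob (R : realType) (m1 m2 : R) (k : 'rV[R]_3) (theta : R)
    (sigma rho : flavor) (t : R) : R :=
  match sigma, rho with
  | flavor_e, flavor_mu | flavor_mu, flavor_e => Q_change m1 m2 k theta t
  | flavor_e, flavor_e | flavor_mu, flavor_mu => 1 - Q_change m1 m2 k theta t
  end.

Definition Ccomm (R : realType) (m1 m2 : R) (k : 'rV[R]_3) (theta t : R) : R :=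
  sin (2 * theta) *
  `| bogo_U m1 m2 k ^+ 2 * sin (2 * omega_minus m1 m2 k * t) +
     bogo_V m1 m2 k ^+ 2 * sin (2 * omega_plus m1 m2 k * t) |.

Definition F_QFT (R : realType) (m1 m2 : R) (k : 'rV[R]_3) (theta : R)
    (sigma : flavor) (t : R) : R :=
  Qprob m1 m2 k theta sigma sigma t * (1 - Qprob m1 m2 k theta sigma sigma t)
  - 1 / 4 * Ccomm m1 m2 k theta t ^+ 2.

Definition W_QFT (R : realType) (m1 m2 : R) (k : 'rV[R]_3) (theta t : R) : R :=
  Qprob m1 m2 k theta flavor_e flavor_e t *
  Qprob m1 m2 k theta flavor_mu flavor_e t
  - Qprob m1 m2 k theta flavor_mu flavor_e (2 * t).

(* Main.v *)
Require Import Defs.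
From mathcomp Require Import all_boot all_order all_algebra.
From mathcomp Require Import reals trigo.
From mathcomp Require Import ring lra.

Import Order.TTheory GRing.Theory Num.Theory.
Local Open Scope ring_scope.

(** The products of probabilities in F and W coincide, so F - W is
    Q_change (2t) - C^2(t) / 4.  As |U|^2 + |V|^2 = 1, convexity of the square
    bounds C^2(t) by Q_change (2t), so even F - W >= 3/4 Q_change (2t). *)

Lemma sqr_omega (R : realType) (m : R) (k : 'rV[R]_3) :
  omega m k ^+ 2 = norm_euclid k ^+ 2 + m ^+ 2.
Proof. by rewrite sqr_sqrtr // addr_ge0 // sqr_ge0. Qed.

Lemma omega_gt0 (R : realType) (m : R) (k : 'rV[R]_3) :
  0 < m -> 0 < omega m k.
Proof. by move=> m_gt0; rewrite sqrtr_gt0 ltr_wpDl ?sqr_ge0 ?exprn_gt0. Qed.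

(** This is the normalisation of a Dirac spinor. With w for [omega m k], the square of the momentum
    is (w - m)(w + m), so the second factor equals 1 + (w - m)/(w + m) = 2w/(w + m), the inverse of
    the first. *)
Lemma norm_omega_frac (R : realType) (m : R) (k : 'rV[R]_3) : 0 < m ->
  (omega m k + m) / (2 * omega m k) *
  (1 + (norm_euclid k / (omega m k + m)) ^+ 2) = 1.
Proof.
move=> m_gt0; have w_gt0 := omega_gt0 R m k m_gt0.
have a_neq0 : omega m k + m != 0 by rewrite gt_eqF ?addr_gt0.
have w_neq0 : omega m k != 0 by rewrite gt_eqF.
have n2E : norm_euclid k ^+ 2 = omega m k ^+ 2 - m ^+ 2.
  by rewrite sqr_omega addrK.
by rewrite expr_div_n n2E; field; rewrite a_neq0 w_neq0.
Qed.

(** Set a = |k|/(w1 + m1) and b = |k|/(w2 + m2). Up to the common factor [bogo_A], U is 1 + ab and V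
    is a - b, and (1 + ab)^2 + (a - b)^2 = (1 + a^2)(1 + b^2). The sum of squares thus splits into
    one normalised factor per mass. *)
Lemma bogo_sqrD (R : realType) (m1 m2 : R) (k : 'rV[R]_3) :
  0 < m1 -> 0 < m2 -> bogo_U m1 m2 k ^+ 2 + bogo_V m1 m2 k ^+ 2 = 1.
Proof.
move=> m1_gt0 m2_gt0.
have w1_gt0 := omega_gt0 R m1 k m1_gt0; have w2_gt0 := omega_gt0 R m2 k m2_gt0.
have a1_gt0 := addr_gt0 w1_gt0 m1_gt0; have a2_gt0 := addr_gt0 w2_gt0 m2_gt0.
have sqrA : bogo_A m1 m2 k ^+ 2 = (omega m1 k + m1) / (2 * omega m1 k) *
    ((omega m2 k + m2) / (2 * omega m2 k)).
  by rewrite sqr_sqrtr // mulr_ge0 // divr_ge0 ?mulr_ge0 // ltW.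
rewrite /bogo_U /bogo_V !exprMn sqrA.
transitivity ((omega m1 k + m1) / (2 * omega m1 k) *
    (1 + (norm_euclid k / (omega m1 k + m1)) ^+ 2) *
    ((omega m2 k + m2) / (2 * omega m2 k) *
    (1 + (norm_euclid k / (omega m2 k + m2)) ^+ 2))); last first.
  by rewrite !norm_omega_frac // mulr1.
by field; rewrite !gt_eqF.
Qed.

(** The gap between the two sides is the variance p q (x - y)^2 of a two-point distribution with
    weights p and q. *)
Lemma sqr_convex_comb_le (R : realDomainType) (p q x y : R) :
  0 <= p -> 0 <= q -> p + q = 1 ->
  (p * x + q * y) ^+ 2 <= p * x ^+ 2 + q * y ^+ 2.
Proof.
move=> p_ge0 q_ge0 pq1; rewrite -subr_ge0.
have qE : q = 1 - p by rewrite -pq1 addrC addKr.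
have -> : p * x ^+ 2 + q * y ^+ 2 - (p * x + q * y) ^+ 2 =
          p * q * (x - y) ^+ 2 by rewrite qE; ring.
by rewrite mulr_ge0 ?sqr_ge0 // mulr_ge0.
Qed.

Lemma Q_change_ge0 (R : realType) (m1 m2 : R) (k : 'rV[R]_3) (theta t : R) :
  0 <= Q_change m1 m2 k theta t.
Proof. by rewrite mulr_ge0 ?sqr_ge0 // addr_ge0 // mulr_ge0 ?sqr_ge0. Qed.

Lemma sqr_Ccomm_le (R : realType) (m1 m2 : R) (k : 'rV[R]_3) (theta t : R) :
  0 < m1 -> 0 < m2 ->
  Ccomm m1 m2 k theta t ^+ 2 <= Q_change m1 m2 k theta (2 * t).
Proof.
move=> m1_gt0 m2_gt0; rewrite /Ccomm /Q_change exprMn real_normK ?num_real //.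
(* Doubling the time in [Q_change] gives the angles that [Ccomm] has at time t. Once they are
   written alike, the same two sines occur on both sides, with the squares of U and V as weights. *)
rewrite ler_wpM2l ?sqr_ge0 // !(mulrCA _ 2 t) !(mulrA 2).
by rewrite sqr_convex_comb_le ?sqr_ge0 ?bogo_sqrD.
Qed.

(** [Qprob] only sees whether the two flavors agree, so for either [sigma] the product in F is (1 -
    Q) Q with Q the change probability at time t, as in W. *)
Lemma F_QFT_subW (R : realType) (m1 m2 : R) (k : 'rV[R]_3) (theta t : R)
    (sigma : flavor) :
  F_QFT m1 m2 k theta sigma t - W_QFT m1 m2 k theta t =
  Q_change m1 m2 k theta (2 * t) - 1 / 4 * Ccomm m1 m2 k theta t ^+ 2.
Proof. by rewrite /F_QFT /W_QFT; case: sigma => /=; ring. Qed.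

Theorem mainTheorem2 (R : realType) (m1 m2 : R) (k : 'rV[R]_3)
    (theta t : R) (sigma : flavor) (m1_gt0 : 0 < m1) (m2_gt0 : 0 < m2) :
  F_QFT m1 m2 k theta sigma t - W_QFT m1 m2 k theta t >= 0.
Proof.
rewrite F_QFT_subW.
have Q_ge0 := Q_change_ge0 R m1 m2 k theta (2 * t).
have C_le := sqr_Ccomm_le R m1 m2 k theta t m1_gt0 m2_gt0.
lra.
Qed.
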